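(* Let $d\ge 1$ and $\eta>0$. Consider two agents with opinions $\mathbf{X}_t^{(1)},\mathbf{X}_t^{(2)}\in\mathbb{S}^{d-1}$ following the HJMR dynamics $\mathbf{X}_{t+1}^{(i)}=P_{\mathbb{S}^{d-1}}\big(\mathbf{X}_t^{(i)}+\eta\langle\mathbf{X}_t^{(i)},\xi_t\rangle\xi_t\big)$, $i=1,2$, where $\xi_0,\xi_1,\ldots$ are i.i.d. uniform on the standard basis $\{\mathbf{e}_1,\ldots,\mathbf{e}_d\}$. Let $\mathbf{X}_0=(\mathbf{X}_0^{(1)},\mathbf{X}_0^{(2)})$ be such that $\mathbf{X}_0^{(1)}$ and $\mathbf{X}_0^{(2)}$ have the same support (the same set of nonzero coordinates) but $\mathbf{X}_0^{(1)}\neq\pm\mathbf{X}_0^{(2)}$. Then: (1) $\mathbf{X}_t$ weakly polarizes: for every $\epsilon>0$, $\Pr(\rho(\mathbf{X}_t,P)\ge\epsilon)\to 0$ as $t\to\infty$. (2) With probability $1$, $\|\mathbf{X}_t^{(1)}-\mathbf{X}_t^{(2)}\|_2$ converges neither to $0$ nor to $2$; in particular $\mathbf{X}_t$ does not strongly polarize with positive probability.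
   Context: $\mathbb{S}^{d-1}$ is the unit sphere in $\mathbb{R}^d$, $P_{\mathbb{S}^{d-1}}(\mathbf{x})=\mathbf{x}/\|\mathbf{x}\|_2$. The polarized set (for two agents) is $P=\{(\mathbf{x},\sigma\mathbf{x}):\mathbf{x}\in\mathbb{S}^{d-1},\sigma\in\{-1,1\}\}$ and $\rho(\mathbf{z},P)=\inf_{\mathbf{y}\in P}\|\mathbf{z}-\mathbf{y}\|_2$. Strong polarization means $\rho(\mathbf{X}_t,P)\to0$ almost surely. *)

(* Defs.v *)
From HB Require Import structures.
From mathcomp Require Import all_boot all_order all_algebra.
From mathcomp Require Import all_classical all_reals all_analysis.
Set Implicit Arguments. Unset Strict Implicit. Unset Printing Implicit Defensive.
Import Order.TTheory GRing.Theory Num.Theory numFieldNormedType.Exports.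
Local Open Scope ring_scope.
Local Open Scope classical_set_scope.

Section HJMR.
Variables (R : realType) (d : nat).

Definition norm2 (x : 'rV[R]_d) : R := Num.sqrt (\sum_(i < d) x 0 i ^+ 2).

Definition proj_sphere (x : 'rV[R]_d) : 'rV[R]_d := (norm2 x)^-1 *: x.

Definition ebasis (k : 'I_d) : 'rV[R]_d := delta_mx 0 k.

Definition inner (x y : 'rV[R]_d) : R := \sum_(i < d) x 0 i * y 0 i.

Definition hjmr_step (eta : R) (k : 'I_d) (x : 'rV[R]_d) : 'rV[R]_d :=
  proj_sphere (x + (eta * inner x (ebasis k)) *: ebasis k).

Fixpoint hjmr_traj (eta : R) (xs : nat -> 'I_d) (x0 : 'rV[R]_d) (t : nat)
  : 'rV[R]_d :=
  match t with
  | 0 => x0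
  | t'.+1 => hjmr_step eta (xs t') (hjmr_traj eta xs x0 t')
  end.

(* distance of z = (z1, z2) in R^d x R^d to the polarized set
   P = {(x, sigma x) : x in S^{d-1}, sigma in {-1,1}} *)
Definition rho_pol (z1 z2 : 'rV[R]_d) : R :=
  inf [set r : R | exists (x : 'rV[R]_d) (s : R),
        norm2 x = 1 /\ (s = 1 \/ s = -1) /\
        r = Num.sqrt (norm2 (z1 - x) ^+ 2 + norm2 (z2 - s *: x) ^+ 2)].

Definition supp (x : 'rV[R]_d) : set 'I_d := [set i | x 0 i != 0].

End HJMR.

Definition seq_cvg_to (R : realType) (u : nat -> R) (l : R) : Prop :=
  u @ \oo --> l.

(* Main.v *)
(* Coordinate k of X_t is proportional to (1 + eta)^(N_k(t)) x_k, where N_k(t)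
   counts the draws of e_k before time t.  If the differences between the counts
   are all large, both agents are close to plus or minus the same basis vector;
   since N_i - N_j reduced modulo a large odd M equidistributes (the l2 norm of its
   law loses energy as long as the law is not flat), small differences have
   vanishing probability.  This gives weak polarization.

   By symmetry and the same anti-concentration, in a long enough block of draws
   any given i beats all other coordinates by any prescribed margin with
   probability at least 1/(2d); hence almost surely every i is a leader of the
   counts infinitely often.  The agents differ by more than a sign, so some minor
   x1_i x2_j - x1_j x2_i is nonzero; as the lead travels between i and j, two
   coordinates with a nonzero minor must tie for the lead infinitely often.  At
   such times the minor of the current opinions is at least the initial one in
   absolute value, while it is at most 4 rho. *)
Require Import Defs.
From HB Require Import structures.
From mathcomp Require Import all_boot all_order all_algebra.
From mathcomp Require Import all_classical all_reals all_analysis.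
From mathcomp Require Import perm ring lra zify.
Import Order.TTheory GRing.Theory Num.Theory numFieldNormedType.Exports.
Local Open Scope ring_scope.
Local Open Scope classical_set_scope.

(** * Averages over random words, and anti-concentration of count differences *)

Section WordMean.
Context {R : realType} {d : nat}.
Implicit Types (f g : seq 'I_d -> R) (s : seq 'I_d) (i j k : 'I_d).

(** The expectation of [f] over [n] independent uniform letters. The recursion on the first letter
    keeps the probabilistic estimates finite, away from the measure [P]. *)
Fixpoint word_mean n f : R :=
  if n is m.+1 then d%:R^-1 * \sum_(k < d) word_mean m (fun s => f (k :: s))
  else f [::].

Lemma word_mean_cat m n f :
  word_mean (m + n) f = word_mean m (fun s => word_mean n (fun s' => f (s ++ s'))).
Proof.
elim: m f => [//|m IH] f; rewrite addSn /=.
by congr (_ * _); apply: eq_bigr => k _; rewrite IH.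
Qed.

Lemma ler_word_mean n f g :
  (forall s, size s = n -> f s <= g s) -> word_mean n f <= word_mean n g.
Proof.
elim: n f g => [|n IH] f g fg /=; first exact: fg.
rewrite ler_wpM2l ?invr_ge0 ?ler0n//; apply: ler_sum => k _.
by apply: IH => s ss; apply: fg; rewrite /= ss.
Qed.

Lemma eq_word_mean n f g :
  (forall s, size s = n -> f s = g s) -> word_mean n f = word_mean n g.
Proof.
by move=> fg; apply/eqP; rewrite eq_le; apply/andP; split;
  apply: ler_word_mean => s /fg ->.
Qed.

Lemma word_mean_sum (I : Type) (r : seq I) (P : pred I) n (F : I -> seq 'I_d -> R) :
  word_mean n (fun s => \sum_(x <- r | P x) F x s)
  = \sum_(x <- r | P x) word_mean n (F x).
Proof.
elim: n F => [//|n IH] F /=.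
under eq_bigr do rewrite IH.
by rewrite exchange_big /= mulr_sumr.
Qed.

Lemma word_meanZ n c f : word_mean n (fun s => c * f s) = c * word_mean n f.
Proof.
elim: n f => [//|n IH] f /=.
by under eq_bigr do rewrite IH; rewrite -mulr_sumr mulrCA.
Qed.

Lemma word_mean_map n f (p : {perm 'I_d}) :
  word_mean n (fun s => f (map p s)) = word_mean n f.
Proof.
elim: n f => [//|n IH] f /=; congr (_ * _).
rewrite [RHS](reindex_inj (@perm_inj _ p)) /=.
by apply: eq_bigr => k _; exact: (IH (fun s => f (p k :: s))).
Qed.

Lemma word_mean_ge0 n f : (forall s, 0 <= f s) -> 0 <= word_mean n f.
Proof.
elim: n f => [|n IH] f f0 /=; first exact: f0.
by rewrite mulr_ge0 ?invr_ge0 ?ler0n ?sumr_ge0// => k _; apply: IH.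
Qed.

Hypothesis d_gt0 : (0 < d)%N.

Let dR_neq0 : d%:R != 0 :> R.
Proof. by rewrite pnatr_eq0 -lt0n. Qed.

Lemma word_mean_cst n c : word_mean n (fun=> c) = c.
Proof.
elim: n => [//|n IH] /=.
by rewrite IH sumr_const card_ord -[c *+ d]mulr_natl mulrA mulVf// mul1r.
Qed.

Lemma word_meanB n f g : word_mean n (fun s => f s - g s) = word_mean n f - word_mean n g.
Proof.
elim: n f g => [//|n IH] f g /=.
by under eq_bigr do rewrite IH; rewrite sumrB mulrBr.
Qed.

(** The right-hand side is the variance of [y] under the uniform law. Keep only its terms at [i] and
    [j], and use 2(a^2 + b^2) = (a - b)^2 + (a + b)^2 for the deviations from the mean. *)
Lemma mean_sqr_gap (y : 'I_d -> R) i j : i != j ->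
  (y i - y j) ^+ 2 / (2 * d%:R)
  <= d%:R^-1 * (\sum_k y k ^+ 2) - (d%:R^-1 * \sum_k y k) ^+ 2.
Proof.
move=> ij; set m := d%:R^-1 * \sum_k y k.
have mE : \sum_k y k = d%:R * m by rewrite /m mulrA mulfV// mul1r.
have -> : d%:R^-1 * (\sum_k y k ^+ 2) - m ^+ 2 = d%:R^-1 * \sum_k (y k - m) ^+ 2.
  under [in RHS]eq_bigr do rewrite sqrrB.
  rewrite big_split/= sumrB sumrMnl -mulr_suml mE.
  by rewrite sumr_const card_ord -[m ^+ 2 *+ d]mulr_natl; field.
rewrite invfM mulrA [X in X <= _]mulrC ler_wpM2l ?invr_ge0 ?ler0n//.
rewrite (bigD1 i)//= (bigD1 j)/=; last by rewrite eq_sym.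
rewrite addrA ler_wpDr//; first by apply: sumr_ge0 => k _; exact: sqr_ge0.
by have := sqr_ge0 ((y i - m) + (y j - m)); nra.
Qed.

Section AntiConcentration.
Variables (M : nat) (i j : 'I_d).
Hypotheses (M_gt1 : (1 < M)%N) (M_odd : odd M) (ij : i != j).

(** The probability that the walk N_i - N_j modulo [M], started at [x], is at 0 after [t] draws. As
    a function of the starting point it satisfies a one-step recursion on the first letter. *)
Definition return_mean t (x : 'Z_M) : R :=
  word_mean t (fun s => (x + (count_mem i s)%:R - (count_mem j s)%:R == 0)%:R).

Let incr k : 'Z_M := (k == i)%:R - (k == j)%:R.

Lemma return_meanS t x :
  return_mean t.+1 x = d%:R^-1 * \sum_(k < d) return_mean t (x + incr k).
Proof.
congr (_ * _); apply: eq_bigr => k _; apply: eq_word_mean => s _ /=.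
by rewrite !natrD /incr; congr ((_ == _)%:R); ring.
Qed.

Let shift_sum (f : 'Z_M -> R) y : \sum_x f (x + y) = \sum_x f x.
Proof. by rewrite [RHS](reindex_inj (addIr y)). Qed.

Lemma return_mean_sum t : \sum_x return_mean t x = 1.
Proof.
elim: t => [|t IH].
  rewrite (bigD1 0)//= /return_mean/= addr0 subr0 eqxx big1 ?addr0// => x x0.
  by rewrite addr0 subr0 (negbTE x0).
under eq_bigr do rewrite return_meanS.
rewrite -mulr_sumr exchange_big/=.
under eq_bigr do rewrite shift_sum IH.
by rewrite sumr_const card_ord mulVf.
Qed.

Let energy t := \sum_x return_mean t x ^+ 2.

(** One step replaces the function by an average of its translates, which all have the same energy,
    so the loss is a sum over the residues of variances. Only the one at [x] is kept, where the
    letters [i] and [j] lead to [x + 1] and [x - 1]. *)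
Lemma return_mean_energy t x :
  (return_mean t (x + 1) - return_mean t (x - 1)) ^+ 2 / (2 * d%:R)
  <= energy t - energy t.+1.
Proof.
have -> : energy t = \sum_x d%:R^-1 * \sum_(k < d) return_mean t (x + incr k) ^+ 2.
  rewrite -mulr_sumr exchange_big/=.
  under eq_bigr do rewrite (shift_sum (fun x => return_mean t x ^+ 2)).
  by rewrite sumr_const card_ord -[energy t *+ d]mulr_natl mulrA mulVf ?mul1r.
have gap y := mean_sqr_gap (fun k => return_mean t (y + incr k)) _ _ ij.
rewrite /energy -sumrB (bigD1 x)//= return_meanS.
have iE : incr i = 1 by rewrite /incr eqxx (negbTE ij) subr0.
have jE : incr j = -1 by rewrite /incr eqxx eq_sym (negbTE ij) sub0r.
have := gap x; rewrite iE jE => gx; apply: (le_trans gx).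
rewrite lerDl; apply: sumr_ge0 => y _; rewrite return_meanS.
by apply: le_trans (gap y); rewrite mulr_ge0 ?sqr_ge0 ?invr_ge0 ?mulr_ge0 ?ler0n.
Qed.

(** The energy decreases and is nonnegative, hence converges; its successive drops tend to 0 and
    dominate the squared differences. *)
Lemma return_mean_diff2_cvg0 x :
  (return_mean t (x + 1) - return_mean t (x - 1)) @[t --> \oo] --> 0.
Proof.
have energy_cvg : cvgn energy.
  apply: nonincreasing_is_cvgn.
    apply/nonincreasing_seqP => t; rewrite -subr_ge0.
    apply: le_trans (return_mean_energy t x).
    by rewrite mulr_ge0 ?sqr_ge0 ?invr_ge0 ?mulr_ge0 ?ler0n.
  by exists 0 => _ [t _ <-]; apply: sumr_ge0 => y _; exact: sqr_ge0.
have drop_cvg : (energy t - energy t.+1) @[t --> \oo] --> 0.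
  rewrite -(subrr (limn energy)); apply: cvgB => //.
  by rewrite (cvg_shiftS energy).
apply/cvgrPdist_lt => e e0.
have e1 : 0 < e ^+ 2 / (2 * d%:R).
  by rewrite divr_gt0 ?exprn_gt0 ?mulr_gt0 ?ltr0n.
have [N _ HN] := (cvgrPdist_lt _ _).1 drop_cvg _ e1; exists N => // t /HN /=.
rewrite !sub0r !normrN => Ht.
have {Ht} := le_lt_trans (return_mean_energy t x) (le_lt_trans (ler_norm _) Ht).
rewrite ltr_pM2r ?invr_gt0 ?mulr_gt0 ?ltr0n//.
by rewrite -real_normK ?num_real// ltr_pXn2r ?nnegrE ?normr_ge0 ?ltW.
Qed.

Lemma return_mean_diff_cvg0 x y :
  (return_mean t x - return_mean t y) @[t --> \oo] --> 0.
Proof.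
have step2 m : (return_mean t x - return_mean t (x + m%:R * 2)) @[t --> \oo] --> 0.
  elim: m => [|m IH].
    by rewrite mul0r addr0; under eq_fun do rewrite subrr; exact: cvg_cst.
  rewrite (_ : (fun t => _) = (fun t => (return_mean t x - return_mean t (x + m%:R * 2))
      - (return_mean t (x + m.+1%:R * 2) - return_mean t (x + m%:R * 2)))); last first.
    by apply/funext => t; ring.
  rewrite -[0]subr0; apply: cvgB => //.
  have := return_mean_diff2_cvg0 (x + m%:R * 2 + 1); rewrite addrK.
  by rewrite (_ : x + m%:R * 2 + 1 + 1 = x + m.+1%:R * 2)// -(natr1 m); ring.
(* 2 is invertible modulo the odd number M, with inverse (M + 1) / 2 *)
have half2 : ((M.+1)./2)%:R * 2 = 1 :> 'Z_M.
  rewrite -natrM muln2 -[RHS]add0r -(pchar_Zp M_gt1) natr1.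
  by congr _%:R; have := odd_double_half M.+1; rewrite /= M_odd.
have -> : y = x + ((y - x)%R * (M.+1)./2)%:R * 2.
  by rewrite natrM natr_Zp -mulrA half2; ring.
exact: step2.
Qed.

(** The [M] values sum to 1 and become pairwise closer than 1/M; summing the differences to the
    value at [x] gives M f(x) - 1 <= 1. *)
Lemma return_mean_near x : \forall t \near \oo, return_mean t x <= 2 / M%:R.
Proof.
have M0 : 0 < M%:R :> R by rewrite ltr0n ltnW.
have close : \forall t \near \oo, forall y, `|return_mean t x - return_mean t y| <= M%:R^-1.
  apply: filter_forall => y.
  by apply: (cvgr0_norm_le _ (return_mean_diff_cvg0 x y)); rewrite invr_gt0.
near=> t.
have : \sum_y (return_mean t x - return_mean t y) <= \sum_(y : 'Z_M) M%:R^-1.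
  apply: ler_sum => y _; apply: le_trans (ler_norm _) _; move: y.
  by near: t.
have cM : #|'Z_M| = M by rewrite card_ord Zp_cast.
rewrite sumrB return_mean_sum !sumr_const cM -[X in _ <= X]mulr_natl mulfV ?gt_eqF//.
by rewrite ler_pdivlMr// -mulr_natr; lra.
Unshelve. all: by end_near.
Qed.
End AntiConcentration.

Definition near_tie C i j s :=
  (count_mem i s <= count_mem j s + C)%N && (count_mem j s <= count_mem i s + C)%N.

(** A near tie confines N_i - N_j modulo [M] to the 2C + 1 residues of -C, ..., C, each of mass at
    most 2/M eventually, and [M] may be taken as large as desired once [C] is fixed. *)
Lemma word_mean_near_tie C i j : i != j ->
  word_mean t (fun s => (near_tie C i j s)%:R) @[t --> \oo] --> 0.
Proof.
move=> ij; apply/cvgr0Pnorm_le => e e0.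
have [K HK] : exists K : nat, (2 * C).+1%:R * 2 / e < K%:R.
  by exists (Num.bound ((2 * C).+1%:R * 2 / e)); apply: le_lt_trans (archi_boundP _);
    rewrite ?lexx// divr_ge0// ltW.
(* Odd, greater than 1 so that ['Z_M] really has [M] elements, and at least [K]. *)
set M := (2 * K).+3.
have M_odd : odd M by rewrite /= oddM.
have near_ret : \forall t \near \oo, forall c : 'I_(2 * C).+1,
    return_mean M i j t (c%:R - C%:R) <= 2 / M%:R.
  by apply: filter_forall => c; exact: return_mean_near.
near=> t.
rewrite ger0_norm; last exact: word_mean_ge0.
apply: (@le_trans _ _ (\sum_(c < (2 * C).+1) return_mean M i j t (c%:R - C%:R))).
  rewrite /return_mean -word_mean_sum; apply: ler_word_mean => s _.
  case tie: (near_tie C i j s); last by apply: sumr_ge0.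
  (* The index c = N_j - N_i + C, between 0 and 2C in a near tie, is the one whose indicator equals
     1. *)
  have cP : (count_mem j s + C - count_mem i s < (2 * C).+1)%N.
    by move: tie; rewrite /near_tie; lia.
  rewrite (bigD1 (Ordinal cP))//=.
  have -> : (count_mem j s + C - count_mem i s)%:R - C%:R
      + (count_mem i s)%:R - (count_mem j s)%:R == 0 :> 'Z_M.
    by rewrite natrB ?natrD; [apply/eqP; ring | move: tie; rewrite /near_tie; lia].
  by rewrite lerDl sumr_ge0.
apply: (@le_trans _ _ (\sum_(c < (2 * C).+1) 2 / M%:R)).
  by apply: ler_sum => c _; move: c; near: t.
rewrite sumr_const card_ord -[X in X <= _]mulr_natl mulrA.
have KM : K%:R <= M%:R :> R by rewrite ler_nat /M; lia.
rewrite ler_pdivrMr ?ltr0n//.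
by rewrite -ler_pdivrMl// mulrC; exact: le_trans (ltW HK) KM.
Unshelve. all: by end_near.
Qed.
End WordMean.

(** * The law of a finite prefix of the draws, expressed by word averages *)

Section PrefixLaw.
Context {R : realType} {d : nat} {dm : measure_display} {T : measurableType dm}.
Variables (P : probability T R) (xi : nat -> T -> 'I_d).
Hypothesis xi_meas : forall k i, measurable [set w | xi k w = i].
Hypothesis xi_cylinder : forall n (s : nat -> 'I_d),
  P [set w | forall k, (k < n)%N -> xi k w = s k] = ((d%:R^-1) ^+ n)%:E.

Let prefix n w := mkseq (xi ^~ w) n.

Lemma measurable_prefix_eq n (s : seq 'I_d) : measurable [set w | prefix n w = s].
Proof.
elim: n s => [|n IH] s.
  case: s => [|k s]; first by rewrite (_ : [set _ | _] = setT)//; apply/seteqP; split.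
  by rewrite (_ : [set _ | _] = set0)//; apply/seteqP; split.
case/lastP: s => [|s k].
  by rewrite (_ : [set _ | _] = set0)//; apply/seteqP; split => w //=.
rewrite (_ : [set _ | _] = [set w | prefix n w = s] `&` [set w | xi n w = k]).
  exact: measurableI.
apply/seteqP; split => w /=; rewrite /prefix mkseqS; first by move/rcons_inj => [-> ->].
by move=> [-> ->].
Qed.

Lemma prefix_eq_prob (s : seq 'I_d) : (0 < d)%N ->
  P [set w | prefix (size s) w = s] = ((d%:R^-1) ^+ size s)%:E.
Proof.
move=> d0; rewrite -(xi_cylinder _ (nth (Ordinal d0) s)); congr (P _).
apply/seteqP; split => w /= => [<- k|H].
  by rewrite size_mkseq => kn; rewrite nth_mkseq.
by apply: (@eq_from_nth _ (Ordinal d0)); rewrite size_mkseq// => k kn; rewrite nth_mkseq// H.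
Qed.

(** Fixing an initial word [s] makes the induction on [n] work: the event splits disjointly
    according to the letter after [s], as in the recursion of [word_mean]. The case of empty [s] is
    the law of the prefix. *)
Lemma prefix_prob_cond n (s : seq 'I_d) (p : pred (seq 'I_d)) : (0 < d)%N ->
  let A := [set w | prefix (size s) w = s /\ p (prefix (size s + n) w)] in
  measurable A /\
  P A = ((d%:R^-1) ^+ size s * word_mean n (fun s' => (p (s ++ s'))%:R))%:E.
Proof.
move=> d0; elim: n s => [|n IH] s /=.
  rewrite cats0; case ps: (p s).
    rewrite (_ : [set _ | _] = [set w | prefix (size s) w = s]).
      split; first exact: measurable_prefix_eq.
      by rewrite prefix_eq_prob// mulr1.
    by apply/seteqP; split => w /=; rewrite addn0; [case | move=> ->].
  rewrite (_ : [set _ | _] = set0) ?measure0 ?mulr0//.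
  by apply/seteqP; split => w //=; rewrite addn0 => -[->]; rewrite ps.
set F := fun k : 'I_d =>
  [set w | prefix (size (rcons s k)) w = rcons s k /\ p (prefix (size (rcons s k) + n) w)].
have -> : [set w | prefix (size s) w = s /\ p (prefix (size s + n.+1) w)]
    = \big[setU/set0]_(k < d) F k.
  rewrite -bigcup_seq; apply/seteqP; split => w /=.
    move=> [ws pw]; exists (xi (size s) w) => /=; first by rewrite mem_index_enum.
    by rewrite /F/= size_rcons /prefix mkseqS -/(prefix _ w) ws addSnnS.
  move=> [k _ [+ pw]]; move: pw; rewrite size_rcons addSnnS /prefix mkseqS.
  by move=> pw /rcons_inj [ws _].
split; first by apply: bigsetU_measurable => k _; exact: (IH (rcons s k)).1.
rewrite measure_semi_additive_ord//; first last.
- by apply: bigsetU_measurable => k _; exact: (IH (rcons s k)).1.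
- move=> k l _ _ [w [[+ _] [+ _]]]; rewrite !size_rcons => -> /rcons_inj[]//.
- by move=> k; exact: (IH (rcons s k)).1.
rewrite (eq_bigr _ (fun k _ => (IH (rcons s k)).2)) sumEFin; congr (_%:E).
rewrite mulrA -exprSr mulr_sumr; apply: eq_bigr => k _.
by rewrite size_rcons; congr (_ * _); apply: eq_word_mean => s' _; rewrite cat_rcons.
Qed.

Lemma prefix_prob n (p : pred (seq 'I_d)) : (0 < d)%N ->
  measurable [set w | p (prefix n w)] /\
  P [set w | p (prefix n w)] = (word_mean n (fun s => (p s)%:R))%:E.
Proof.
move=> d0; have := prefix_prob_cond n [::] p d0; rewrite /= expr0 mul1r add0n.
by rewrite (_ : [set w | _ /\ _] = [set w | p (prefix n w)])//; apply/seteqP; split => w //= [].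
Qed.

End PrefixLaw.

(** * Leaders of the counts in finite words *)

Section Leaders.
Context {R : realType} {d : nat}.
Hypothesis d_gt0 : (0 < d)%N.
Implicit Types (s : seq 'I_d) (i j k : 'I_d).

Definition leads i s := [forall k, (count_mem k s <= count_mem i s)%N].

Definition leads_by C i s :=
  [forall k, (k != i) ==> (count_mem k s + C < count_mem i s)%N].

(** No count in [s] exceeds [C], so the margin won in [s'] outweighs any past. This makes a fresh
    block decisive whatever came before it. *)
Lemma leads_catr C i s s' : (size s <= C)%N -> leads_by C i s' -> leads i (s ++ s').
Proof.
move=> sC /forallP H; apply/forallP => k; rewrite !count_cat.
have [->//|ki] := eqVneq k i; have := H k; rewrite ki /= => Hk.
have ks : (count_mem k s <= size s)%N := count_size _ _.
set a := count_mem k s in ks *; lia.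
Qed.

Lemma leads_by_tperm C i j s : leads_by C j (map (tperm i j) s) = leads_by C i s.
Proof.
have cE k : count_mem k (map (tperm i j) s) = count_mem (tperm i j k) s.
  rewrite count_map; apply: eq_count => l /=.
  by rewrite -(inj_eq (@perm_inj _ (tperm i j))) tpermK.
have E k : (tperm i j k == i) = (k == j) by rewrite -(inj_eq (@perm_inj _ (tperm i j))) tpermK tpermL.
apply/forallP/forallP => H k.
  have := H (tperm i j k); rewrite !cE tpermK tpermR.
  by rewrite -(E (tperm i j k)) tpermK.
by have := H (tperm i j k); rewrite !cE tpermR E.
Qed.

Lemma word_mean_ties_cvg0 C :
  \sum_(i < d) \sum_(j < d | j != i) word_mean n (fun s => (near_tie C i j s)%:R) @[n --> \oo]
    --> (0 : R).
Proof.
have : \sum_i \sum_(j | j != i) word_mean n (fun s => (near_tie C i j s)%:R) @[n --> \oo]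
    --> \sum_(i < d) \sum_(j < d | j != i) (0 : R).
  apply: cvg_big => [|k _]; first exact: add_continuous.
  apply: cvg_big => [|l lk]; first exact: add_continuous.
  by apply: word_mean_near_tie; rewrite // eq_sym.
by rewrite [X in _ --> X]big1 => // k _; rewrite big1.
Qed.

(** A coordinate of maximal count either wins by more than [C] or has a rival within [C]; this is
    the union bound at the level of indicators. *)
Lemma leads_by_or_near_tie C s :
  1 - \sum_i \sum_(j | j != i) (near_tie C i j s)%:R <= \sum_i (leads_by C i s)%:R :> R.
Proof.
rewrite lerBlDr.
have [i iP] : exists i, forall k, (count_mem k s <= count_mem i s)%N.
  by case: (arg_maxnP (P := predT) (i0 := Ordinal d_gt0) (fun i => count_mem i s)) => // i _ H;
    exists i => k; exact: H.
case lead: (leads_by C i s).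
  rewrite (bigD1 i)//= lead -addrA lerDl addr_ge0 ?sumr_ge0// => k _.
  exact: sumr_ge0.
move/forallPn: lead => [k]; rewrite negb_imply => /andP[ki].
rewrite -leqNgt => Hk.
rewrite [X in _ + X](bigD1 i)//= [X in _ + (X + _)](bigD1 k)//=.
rewrite (_ : (near_tie C i k s)%:R = 1); last by rewrite /near_tie Hk (leq_trans (iP k) (leq_addr _ _)).
rewrite [X in _ <= X]addrC -!addrA lerDl !addr_ge0 ?sumr_ge0// => l _; exact: sumr_ge0.
Qed.

(** For long words the near ties have total mass at most 1/2, so the winning probabilities sum to at
    least 1/2; by symmetry under transpositions of letters all [d] of them are equal. *)
Lemma word_mean_leads_by C i :
  \forall n \near \oo, (2 * d%:R)^-1 <= word_mean n (fun s => (leads_by C i s)%:R) :> R.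
Proof.
have d0 : 0 < d%:R :> R by rewrite ltr0n.
have half0 : 0 < 2^-1 :> R by [].
apply: filterS (cvgr0_norm_le _ (word_mean_ties_cvg0 C) _ half0) => n /(le_trans (ler_norm _)) small.
have same k : word_mean n (fun s => (leads_by C k s)%:R)
    = word_mean n (fun s => (leads_by C i s)%:R) :> R.
  rewrite -(word_mean_map _ _ (tperm i k)).
  by apply: eq_word_mean => s _; rewrite leads_by_tperm.
have := ler_word_mean n _ _ (fun s _ => leads_by_or_near_tie C s).
rewrite word_meanB word_mean_cst// !word_mean_sum.
under [X in _ - X]eq_bigr do rewrite word_mean_sum.
rewrite (eq_bigr _ (fun k _ => same k)) sumr_const card_ord -[_ *+ d]mulr_natl => H.
rewrite invfM ler_pdivrMr// mulrC.
lra.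
Qed.

(** A boolean property of a finite word, so that [prefix_prob] computes its probability. *)
Definition never_leads_from t0 i s :=
  [forall r : 'I_(size s).+1, (t0 <= r)%N ==> ~~ leads i (take r s)].

(** Each new block makes [i] lead at its end with probability at least 1/(2d), independently of the
    past, so [m] blocks contribute [m] factors. *)
Lemma word_mean_never_leads t0 i m :
  exists t, word_mean t (fun s => (never_leads_from t0 i s)%:R)
    <= (1 - (2 * d%:R)^-1) ^+ m :> R.
Proof.
(* The extra bound on [t] ensures that the end of the next block is a time that counts. *)
suff [t _ ?] : exists2 t, (t0 <= t)%N & word_mean t (fun s => (never_leads_from t0 i s)%:R)
    <= (1 - (2 * d%:R)^-1) ^+ m :> R by exists t.
elim: m => [|m [t t0t IH]].
  exists t0 => //; rewrite expr0 -[leRHS](word_mean_cst d_gt0 t0).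
  by apply: ler_word_mean => s _; case: never_leads_from; rewrite ?ler01 ?lexx.
(* The required margin is [t], the length of the whole past, as [leads_catr] demands. *)
have [L _ /(_ _ (leqnn L)) HL] := word_mean_leads_by t i.
exists (t + L)%N; first exact: leq_trans t0t (leq_addr _ _).
rewrite word_mean_cat exprS.
apply: le_trans (_ : word_mean t (fun s => (1 - (2 * d%:R)^-1) *
    (never_leads_from t0 i s)%:R) <= _); last first.
  rewrite word_meanZ ler_wpM2l// subr_ge0 invf_le1 ?mulr_gt0 ?ltr0n//.
  by rewrite -natrM ler1n muln_gt0.
apply: ler_word_mean => s ss.
apply: le_trans (_ : word_mean L (fun s' => (never_leads_from t0 i s)%:R *
    (1 - (leads_by t i s')%:R)) <= _).
  apply: ler_word_mean => s' ss'.
  case: (boolP (never_leads_from t0 i (s ++ s'))) => [/forallP H|_]; last first.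
    by rewrite mulr_ge0// subr_ge0 lern1 leq_b1.
  have -> : never_leads_from t0 i s.
    apply/forallP => -[r rs] /=; apply/implyP => t0r.
    have rs' : (r < (size (s ++ s')).+1)%N by rewrite size_cat (leq_trans rs)// ltnS leq_addr.
    have := H (Ordinal rs'); rewrite /= t0r /= take_cat.
    move: rs; rewrite ltnS leq_eqVlt => /orP[/eqP ->|->//].
    by rewrite ltnn subnn take0 cats0 take_size.
  have := H ord_max; rewrite /= take_size size_cat ss (leq_trans t0t) ?leq_addr//=.
  case lead: (leads_by t i s') => //; last by rewrite subr0 mulr1.
  by rewrite (@leads_catr t)// ss.
rewrite word_meanZ word_meanB word_mean_cst// mulrC ler_wpM2r// lerB//.
Qed.

End Leaders.

(** * Almost sure recurrence of every leader *)

Section Recurrence.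
Context {R : realType} {d : nat} {dm : measure_display} {T : measurableType dm}.
Variables (P : probability T R) (xi : nat -> T -> 'I_d).
Hypothesis d_gt0 : (0 < d)%N.
Hypothesis xi_meas : forall k i, measurable [set w | xi k w = i].
Hypothesis xi_cylinder : forall n (s : nat -> 'I_d),
  P [set w | forall k, (k < n)%N -> xi k w = s k] = ((d%:R^-1) ^+ n)%:E.

(** For fixed [t0] the bad event lies in every [A t], and these have arbitrarily small probability;
    the countably many [t0] are then combined. *)
Lemma ae_leads_io i : {ae P, forall w, forall t0,
  exists2 t, (t0 <= t)%N & leads i (mkseq (xi ^~ w) t)}.
Proof.
apply: ae_foralln => t0.
pose A t := [set w | never_leads_from t0 i (mkseq (xi ^~ w) t)].
have A_meas t : measurable (A t) by exact: (prefix_prob P xi xi_meas xi_cylinder _ _ _).1.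
have PA t : P (A t) = (word_mean t (fun s => (never_leads_from t0 i s)%:R))%:E.
  exact: (prefix_prob P xi xi_meas xi_cylinder _ _ _).2.
exists (\bigcap_t A t); split.
- exact: bigcap_measurable.
- have d0 : 0 < d%:R :> R by rewrite ltr0n.
  have q1 : `|1 - (2 * d%:R)^-1| < 1 :> R.
    have q0 : 0 < (2 * d%:R)^-1 :> R by rewrite invr_gt0 mulr_gt0.
    have q2 : (2 * d%:R)^-1 <= 1 :> R.
      by rewrite invf_le1 ?mulr_gt0// -natrM ler1n muln_gt0.
    by rewrite ger0_norm ?subr_ge0// ltrBlDr ltrDl.
  apply/eqP; rewrite eq_le measure_ge0 andbT.
  apply/lee_addgt0Pr => e e0; rewrite add0e.
  have [m _ /(_ _ (leqnn m)) Hm] := cvgr0_norm_le _ (cvg_expr q1) _ e0.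
  have [t Ht] := @word_mean_never_leads R d d_gt0 t0 i m.
  apply: (@le_trans _ _ (P (A t))).
    by apply: le_measure; rewrite ?inE//; [exact: bigcap_measurable | move=> w; apply].
  rewrite PA lee_fin; apply: le_trans Ht _; apply: le_trans Hm; exact: ler_norm.
- move=> w /= Hw t _; apply/forallP => -[r rt] /=; apply/implyP => t0r; apply/negP => lead.
  apply: Hw; exists r => //; move: rt lead; rewrite size_mkseq ltnS => rt.
  by rewrite /mkseq -map_take take_iota (minn_idPl rt).
Qed.

End Recurrence.

(** Supplies uniform constants later on: the least nonzero squared coordinate of an opinion and the
    least nonzero absolute minor. *)
Lemma finite_nonzero_lb {R : realType} {I : finType} (f : I -> R) :
  exists2 delta : R, 0 < delta & forall i, f i != 0 -> delta <= `|f i|.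
Proof.
have [|] := pselect (exists i, f i != 0); last first.
  by move=> nof; exists 1 => // i fi; case: nof; exists i.
move=> [i0 fi0]; case: (arg_minP (P := fun i => f i != 0) (fun i => `|f i|) fi0) => i fi H.
by exists `|f i|; rewrite ?normr_gt0.
Qed.

(** * Geometry of the sphere, the polarized set and the minors *)

Section Sphere.
Context {R : realType} {d : nat}.
Implicit Types (x y z u v : 'rV[R]_d) (a b i j k : 'I_d).

Lemma norm2_ge0 x : 0 <= norm2 x.
Proof. exact: sqrtr_ge0. Qed.

Lemma sqr_norm2 x : norm2 x ^+ 2 = \sum_k x 0 k ^+ 2.
Proof. by rewrite sqr_sqrtr// sumr_ge0// => k _; exact: sqr_ge0. Qed.

Lemma norm2Z c x : norm2 (c *: x) = `|c| * norm2 x.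
Proof.
rewrite /norm2; under eq_bigr do rewrite mxE exprMn.
by rewrite -mulr_sumr sqrtrM ?sqr_ge0// sqrtr_sqr.
Qed.

Lemma ler_coord_norm2 x k : `|x 0 k| <= norm2 x.
Proof.
rewrite -(ler_pXn2r (n := 2))// ?nnegrE ?normr_ge0 ?norm2_ge0//.
rewrite sqr_norm2 real_normK ?num_real// (bigD1 k)//= lerDl.
by apply: sumr_ge0 => l _; exact: sqr_ge0.
Qed.

Lemma norm2_eq1_neq0 x : norm2 x = 1 -> exists k, x 0 k != 0.
Proof.
move=> x1; apply: contrapT => x0; have := sqr_norm2 x.
rewrite x1 expr1n big1 => [/eqP|k _]; first by rewrite oner_eq0.
by apply/eqP; rewrite sqrf_eq0; apply: contrapT => /negP xk; apply: x0; exists k.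
Qed.

Lemma norm2_proj_sphere x : norm2 x != 0 -> norm2 (proj_sphere x) = 1.
Proof. by move=> x0; rewrite norm2Z normfV ger0_norm ?norm2_ge0// mulVf. Qed.

Lemma proj_sphereZ c x : 0 < c -> proj_sphere (c *: x) = proj_sphere x.
Proof.
move=> c0; rewrite /proj_sphere norm2Z gtr0_norm// scalerA invfM mulrAC mulVf ?mul1r//.
exact: lt0r_neq0.
Qed.

Definition cross x y a b : R := x 0 a * y 0 b - x 0 b * y 0 a.

(** Minors vanish on the polarized set. Compared with a point of that set, the minor is a signed sum
    of four products, each a coordinate difference, at most the distance, times a coordinate of
    absolute value at most 1. *)
Lemma cross_le_rho_pol u v a b : norm2 u = 1 -> norm2 v = 1 ->
  `|cross u v a b| / 4 <= rho_pol u v.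
Proof.
move=> u1 v1; apply: lb_le_inf.
  by eexists; exists u, 1; split=> //; split; [left|reflexivity].
move=> _ [x [s [x1 [s1 ->]]]].
set r := Num.sqrt _.
have rE : r ^+ 2 = norm2 (u - x) ^+ 2 + norm2 (v - s *: x) ^+ 2.
  by rewrite sqr_sqrtr// addr_ge0 ?sqr_ge0.
have ur k : `|u 0 k - x 0 k| <= r.
  have := ler_coord_norm2 (u - x) k; rewrite !mxE => /le_trans; apply.
  by rewrite -(ler_pXn2r (n := 2))// ?nnegrE ?norm2_ge0 ?sqrtr_ge0// rE lerDl sqr_ge0.
have vr k : `|v 0 k - s * x 0 k| <= r.
  have := ler_coord_norm2 (v - s *: x) k; rewrite !mxE => /le_trans; apply.
  by rewrite -(ler_pXn2r (n := 2))// ?nnegrE ?norm2_ge0 ?sqrtr_ge0// rE lerDr sqr_ge0.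
have vk k : `|v 0 k| <= 1 by rewrite -v1 ler_coord_norm2.
have xk k : `|x 0 k| <= 1 by rewrite -x1 ler_coord_norm2.
have prod (p q : R) : `|p| <= r -> `|q| <= 1 -> `|p * q| <= r.
  by move=> pr q1; rewrite normrM -[leRHS]mulr1 ler_pM.
have -> : cross u v a b = (u 0 a - x 0 a) * v 0 b + (v 0 b - s * x 0 b) * x 0 a
    - (u 0 b - x 0 b) * v 0 a - (v 0 a - s * x 0 a) * x 0 b by rewrite /cross; ring.
have := prod _ _ (ur a) (vk b); have := prod _ _ (vr b) (xk a).
have := prod _ _ (ur b) (vk a); have := prod _ _ (vr a) (xk b).
rewrite ler_pdivrMr//; do 4 rewrite ler_norml => /andP[? ?].
by rewrite ler_norml; apply/andP; split; lra.
Qed.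

Lemma rho_pol_le u v x (s : R) : norm2 x = 1 -> s = 1 \/ s = -1 ->
  rho_pol u v <= Num.sqrt (norm2 (u - x) ^+ 2 + norm2 (v - s *: x) ^+ 2).
Proof.
move=> x1 s1; apply: ge_inf; last by exists x, s.
by exists 0 => _ [? [? [_ [_ ->]]]]; exact: sqrtr_ge0.
Qed.

Lemma norm2_0 : norm2 (0 : 'rV[R]_d) = 0.
Proof. by rewrite /norm2 big1 ?sqrtr0// => k _; rewrite mxE expr0n. Qed.

Lemma rho_pol_le_sub u v : norm2 v = 1 -> rho_pol u v <= norm2 (u - v).
Proof.
move=> v1; have := rho_pol_le u v v 1 v1 (or_introl erefl).
by rewrite scale1r subrr norm2_0 expr0n/= addr0 sqrtr_sqr ger0_norm ?norm2_ge0.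
Qed.

Lemma rho_pol_le_add u v : norm2 v = 1 -> rho_pol u v <= norm2 (u + v).
Proof.
move=> v1; have Nv1 : norm2 (- v) = 1 by rewrite -scaleN1r norm2Z normrN1 mul1r.
have := rho_pol_le u v (- v) (-1) Nv1 (or_intror erefl).
by rewrite scaleN1r !opprK subrr norm2_0 expr0n/= addr0 sqrtr_sqr ger0_norm ?norm2_ge0.
Qed.

Lemma norm2_parallelogram u v : norm2 u = 1 -> norm2 v = 1 ->
  norm2 (u - v) ^+ 2 + norm2 (u + v) ^+ 2 = 4.
Proof.
move=> u1 v1; have := sqr_norm2 u; have := sqr_norm2 v; rewrite u1 v1 !sqr_norm2 expr1n => vE uE.
rewrite -big_split/=.
rewrite (eq_bigr (fun k => 2 * u 0 k ^+ 2 + 2 * v 0 k ^+ 2)); last first.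
  by move=> k _; rewrite !mxE; ring.
by rewrite big_split/= -!mulr_sumr -uE -vE; ring.
Qed.

(** Set to 1 at 0, so that the signed basis vectors are always on the sphere. *)
Let sign (r : R) : R := if r < 0 then -1 else 1.

(** The squared distance equals 2(1 - |u_i|), and |u_i| >= u_i^2 on the sphere. *)
Lemma norm2_ebasis_sub u i : norm2 u = 1 ->
  norm2 (u - sign (u 0 i) *: ebasis R i) ^+ 2 <= 2 * (1 - u 0 i ^+ 2).
Proof.
move=> u1; have := sqr_norm2 u; rewrite u1 expr1n (bigD1 i)//= => uE.
have ui1 : `|u 0 i| <= 1 by rewrite -u1 ler_coord_norm2.
rewrite sqr_norm2 (bigD1 i)//= !mxE !eqxx/= mulr1.
have -> : \sum_(k | k != i) (u - sign (u 0 i) *: ebasis R i) 0 k ^+ 2 = 1 - u 0 i ^+ 2.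
  rewrite uE [RHS]addrC addKr; apply: eq_bigr => k ki.
  by rewrite !mxE (negbTE ki) andbF mulr0 subr0.
move: ui1; rewrite /sign ler_norml => /andP[? ?]; case: ltP => ?; nra.
Qed.

Lemma rho_pol_le_coord u v i : norm2 u = 1 -> norm2 v = 1 ->
  rho_pol u v <= Num.sqrt (2 * (1 - u 0 i ^+ 2) + 2 * (1 - v 0 i ^+ 2)).
Proof.
move=> u1 v1.
have sign_sqr r : sign r * sign r = 1 by rewrite /sign; case: ifP; rewrite ?mulrNN mulr1.
have norm_sign r : `|sign r| = 1 by rewrite /sign; case: ifP; rewrite ?normrN1 ?normr1.
have e1 : norm2 (sign (u 0 i) *: ebasis R i) = 1.
  rewrite norm2Z norm_sign mul1r /norm2 (bigD1 i)//= big1 ?addr0 ?mxE ?eqxx ?expr1n ?sqrtr1//.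
  by move=> k ki; rewrite mxE (negbTE ki) andbF expr0n.
(* This product is the sigma of the chosen polarized point: it turns the signed basis vector near
   [u] into the one near [v]. *)
have s1 : sign (u 0 i) * sign (v 0 i) = 1 \/ sign (u 0 i) * sign (v 0 i) = -1.
  by rewrite /sign; do 2 case: ifP => _; rewrite ?mulrNN ?mulr1 ?mul1r; auto.
apply: le_trans (rho_pol_le u v _ _ e1 s1) _.
rewrite scalerA mulrAC sign_sqr mul1r ler_wsqrtr// lerD// norm2_ebasis_sub//.
Qed.

(** If all minors vanished, [x1] would be a multiple of [x2], with factor 1 or -1 since both are
    unit vectors. *)
Lemma cross_neq0_exists x1 x2 : norm2 x1 = 1 -> norm2 x2 = 1 ->
  x1 != x2 -> x1 != - x2 -> exists i j, cross x1 x2 i j != 0.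
Proof.
move=> n1 n2 x12 x12N; apply: contrapT => H.
have cross0 i j : x1 0 i * x2 0 j = x1 0 j * x2 0 i.
  by apply/eqP; rewrite -subr_eq0; apply: contrapT => /negP ?; apply: H; exists i, j.
have [i xi0] := norm2_eq1_neq0 _ n2.
have E : x1 = (x1 0 i / x2 0 i) *: x2.
  apply/rowP => k; rewrite mxE mulrAC cross0 -mulrA mulfV ?mulr1//.
have := n1; rewrite {1}E norm2Z n2 mulr1 => /eqP.
rewrite eqr_norml ler01 andbT => /orP[] /eqP c.
  by move: x12; rewrite {1}E c scale1r eqxx.
by move: x12N; rewrite {1}E c scaleN1r eqxx.
Qed.

End Sphere.

(** * Explicit trajectories in terms of the counts *)

Section Trajectory.
Context {R : realType} {d : nat}.
Variable eta : R.
Hypothesis eta_gt0 : 0 < eta.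
Implicit Types (x y : 'rV[R]_d) (a b i j k : 'I_d) (s : seq 'I_d).

Let lam_gt0 : 0 < 1 + eta. Proof. by rewrite addr_gt0. Qed.
Let lam_gt1 : 1 < 1 + eta. Proof. by rewrite ltrDl. Qed.

Definition scaled x s : 'rV[R]_d := \row_k ((1 + eta) ^+ count_mem k s * x 0 k).

Lemma norm2_scaled_gt0 x s : norm2 x = 1 -> 0 < norm2 (scaled x s).
Proof.
move=> /norm2_eq1_neq0[k xk]; apply: lt_le_trans (ler_coord_norm2 _ k).
by rewrite mxE normr_gt0 mulf_neq0// expf_neq0// gt_eqF.
Qed.

(** Each intermediate projection only rescales by a positive factor, which the last projection
    absorbs. *)
Lemma hjmr_trajE x (xs : nat -> 'I_d) t : norm2 x = 1 ->
  hjmr_traj eta xs x t = proj_sphere (scaled x (mkseq xs t)).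
Proof.
move=> x1; elim: t => [|t IH] /=.
  rewrite (_ : scaled x _ = x); first by rewrite /proj_sphere x1 invr1 scale1r.
  by apply/rowP => k; rewrite mxE mul1r.
rewrite IH mkseqS /hjmr_step; set z := scaled x _; set k := xs t.
have z0 : 0 < (norm2 z)^-1 by rewrite invr_gt0 norm2_scaled_gt0.
rewrite -[RHS](proj_sphereZ _ _ z0); congr proj_sphere.
have -> : inner (proj_sphere z) (ebasis R k) = (norm2 z)^-1 * z 0 k.
  rewrite /inner (bigD1 k)//= big1 ?addr0.
    by rewrite !mxE !eqxx mulr1.
  by move=> l lk; rewrite !mxE (negbTE lk) andbF mulr0.
apply/rowP => l; rewrite !mxE eqxx/= -/k -cats1 count_cat/= addn0 [l == k]eq_sym.
by case: eqVneq => [->|_]; rewrite /= ?addn0 ?addn1 ?exprS; ring.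
Qed.

(** At a tie both columns of the minor carry the same factor [m]. Since no count on the supports
    exceeds that of [a], the scaled norms are at most [m], so normalizing cannot shrink the minor
    below its initial size. *)
Lemma cross_proj_scaled x y s a b : norm2 x = 1 -> norm2 y = 1 ->
  (forall k, x 0 k != 0 -> (count_mem k s <= count_mem a s)%N) ->
  (forall k, y 0 k != 0 -> (count_mem k s <= count_mem a s)%N) ->
  count_mem b s = count_mem a s ->
  `|cross x y a b| <= `|cross (proj_sphere (scaled x s)) (proj_sphere (scaled y s)) a b|.
Proof.
move=> x1 y1 xa ya ba.
set m := (1 + eta) ^+ count_mem a s.
have m0 : 0 < m by rewrite exprn_gt0.
have norm_le z : norm2 z = 1 -> (forall k, z 0 k != 0 -> (count_mem k s <= count_mem a s)%N) ->
    norm2 (scaled z s) <= m.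
  move=> z1 za; rewrite -(ler_pXn2r (n := 2))// ?nnegrE ?norm2_ge0 ?(ltW m0)//.
  have z2 : \sum_k z 0 k ^+ 2 = 1 by rewrite -sqr_norm2 z1 expr1n.
  rewrite sqr_norm2 -[X in _ <= X]mulr1 -[X in _ <= _ * X]z2 mulr_sumr.
  apply: ler_sum => k _; rewrite mxE exprMn.
  have [->|/za ka] := eqVneq (z 0 k) 0; first by rewrite expr0n !mulr0.
  rewrite ler_wpM2r ?sqr_ge0// ler_pXn2r ?nnegrE ?exprn_ge0 ?(ltW lam_gt0)//.
  by rewrite ler_weXn2l// ltW.
have -> : cross (proj_sphere (scaled x s)) (proj_sphere (scaled y s)) a b
    = (m / norm2 (scaled x s)) * (m / norm2 (scaled y s)) * cross x y a b.
  by rewrite /cross !mxE ba -/m; ring.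
rewrite normrM ler_peMl ?normr_ge0//.
have ge1 z : norm2 z = 1 -> (forall k, z 0 k != 0 -> (count_mem k s <= count_mem a s)%N) ->
    1 <= m / norm2 (scaled z s).
  by move=> z1 za; rewrite ler_pdivlMr ?norm2_scaled_gt0// mul1r norm_le.
apply: le_trans (ler_norm _).
by rewrite -[leLHS]mulr1 ler_pM ?ler01//; exact: ge1.
Qed.

(** The left side is the share of the squared norm outside [i]. With lambda = 1 + eta, the margin
    bounds that tail by lambda^(2(N_i - C)), while the squared norm is at least lambda^(2 N_i)
    x_i^2. *)
Lemma coord_proj_scaled x s i C : norm2 x = 1 -> x 0 i != 0 ->
  (forall k, x 0 k != 0 -> k != i -> (count_mem k s + C <= count_mem i s)%N) ->
  1 - proj_sphere (scaled x s) 0 i ^+ 2 <= ((1 + eta) ^+ 2 ^+ C * x 0 i ^+ 2)^-1.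
Proof.
move=> x1 xi0 lead; set z := scaled x s.
have z0 : 0 < norm2 z by rewrite norm2_scaled_gt0.
have zi0 : 0 < z 0 i ^+ 2.
  by rewrite exprn_even_gt0//= mxE mulf_neq0// expf_neq0// gt_eqF.
have zE : norm2 z ^+ 2 = z 0 i ^+ 2 + \sum_(k | k != i) z 0 k ^+ 2.
  by rewrite sqr_norm2 (bigD1 i).
have tail0 : 0 <= \sum_(k | k != i) z 0 k ^+ 2 by apply: sumr_ge0 => k _; exact: sqr_ge0.
have -> : 1 - proj_sphere z 0 i ^+ 2 = (\sum_(k | k != i) z 0 k ^+ 2) / norm2 z ^+ 2.
  rewrite (_ : \sum_(k | _) _ = norm2 z ^+ 2 - z 0 i ^+ 2); last by rewrite zE addrC addKr.
  by rewrite [proj_sphere z 0 i]mxE; field; rewrite gt_eqF.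
have lamC : 0 < (1 + eta) ^+ 2 ^+ C by rewrite !exprn_gt0.
have xi2 : 0 < x 0 i ^+ 2 by rewrite exprn_even_gt0.
rewrite ler_pdivrMr ?exprn_gt0// [leRHS]mulrC ler_pdivlMr ?(mulr_gt0 lamC xi2)//.
apply: (@le_trans _ _ (z 0 i ^+ 2)); last by rewrite zE lerDl.
rewrite mulrA [z 0 i]mxE [X in _ <= X]exprMn ler_wpM2r ?sqr_ge0// mulr_suml.
apply: (@le_trans _ _ (\sum_k ((1 + eta) ^+ count_mem i s) ^+ 2 * x 0 k ^+ 2)); last first.
  by rewrite -mulr_sumr -sqr_norm2 x1 expr1n mulr1.
rewrite [leRHS](bigD1 i)//=; apply: ler_wpDl; first by rewrite mulr_ge0 ?sqr_ge0.
apply: ler_sum => k ki; rewrite mxE exprMn mulrAC.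
have [->|xk] := eqVneq (x 0 k) 0; first by rewrite expr0n !mulr0.
rewrite ler_wpM2r ?sqr_ge0// -!exprM -exprD ler_weXn2l ?(ltW lam_gt1)//.
by rewrite [(2 * C)%N]mulnC -mulnDl; apply: leq_mul => //; exact: lead.
Qed.

End Trajectory.

(** The lead within [S] passes from [i] in [A] to [j] outside [A], and a draw raises a single count
    by one, so the lead cannot leave [A] without a tie across the boundary. *)
Lemma tied_leaders_io {d : nat} (xs : nat -> 'I_d) (S A : pred 'I_d) i j :
  let N k t := count_mem k (mkseq xs t) in
  S i -> S j -> A i -> ~~ A j ->
  (forall t0, exists2 t, (t0 <= t)%N & leads i (mkseq xs t)) ->
  (forall t0, exists2 t, (t0 <= t)%N & leads j (mkseq xs t)) ->
  forall t0, exists t a b, [/\ (t0 <= t)%N, S a && A a, S b && ~~ A b, N a t = N b t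
    & forall k, S k -> (N k t <= N a t)%N].
Proof.
move=> N Si Sj Ai Aj ioi ioj t0.
have NS k t : N k t.+1 = (N k t + (xs t == k))%N by rewrite /N mkseqS -cats1 count_cat /= addn0.
have [t1 t01 /forallP lead1] := ioi t0.
have [t2 t12 /forallP lead2] := ioj t1.
(* The tie is found at the first time from [t1] on when a coordinate outside [A] attains the maximum
   over [S]. *)
pose Q t := (t1 <= t)%N && [exists b, [&& S b, ~~ A b & [forall k, S k ==> (N k t <= N b t)%N]]].
have exQ : exists t, Q t.
  exists t2; rewrite /Q t12; apply/existsP; exists j; rewrite Sj Aj.
  by apply/forallP => k; apply/implyP => _; exact: lead2.
case: (ex_minnP exQ) => t /andP[t1t /existsP[b /and3P[Sb Ab /forallP bmax]]] tmin.
have bP k : S k -> (N k t <= N b t)%N by move=> Sk; have := bmax k; rewrite Sk.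
suff [a Sa [Aa Nab]] : exists2 a, S a & A a /\ (N b t <= N a t)%N.
  have Nab' : N a t = N b t by apply/eqP; rewrite eqn_leq Nab bP.
  exists t, a, b; split => //; rewrite ?Sa ?Sb ?(leq_trans t01)//.
  by move=> k Sk; rewrite Nab' bP.
(* If that time is [t1] itself, [i] still leads and ties with [b]. Otherwise one step earlier every
   coordinate of [S] outside [A] was strictly below the maximum, so [b] can only have drawn
   level. *)
move: t1t; rewrite leq_eqVlt => /orP[/eqP tE|].
  by exists i => //; split => //; rewrite -tE; exact: lead1.
case: t => [//|t] in bP tmin bmax *; rewrite ltnS => t1t.
have [a Sa amax] : exists2 a, S a & forall k, S k -> (N k t <= N a t)%N.
  case: (arg_maxnP (fun k => N k t) Sb) => a Sa amax.
  by exists a => // k Sk; exact: amax.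
have noQ : ~~ Q t by apply/negP => /tmin; rewrite ltnn.
have notlead k : S k -> ~~ A k -> (N k t < N a t)%N.
  move=> Sk Ak; rewrite ltnNge; apply: contra noQ => ak; rewrite /Q t1t.
  apply/existsP; exists k; rewrite Sk Ak; apply/forallP => l; apply/implyP => Sl.
  exact: leq_trans (amax _ Sl) ak.
exists a => //; split.
  by apply: contraT => Aa; have := notlead a Sa Aa; rewrite ltnn.
by have := notlead b Sb Ab; have := bP a Sa; rewrite !NS; lia.
Qed.

(** Without near ties one coordinate of the common support dominates the others by a factor
    geometric in [C], for both agents at once, so both are close to plus or minus the same basis
    vector. *)
Lemma rho_pol_lt_of_no_tie {R : realType} {d : nat} (eta eps : R) (x1 x2 : 'rV[R]_d) :
  0 < eta -> 0 < eps -> norm2 x1 = 1 -> norm2 x2 = 1 ->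
  (forall k, (x1 0 k != 0) = (x2 0 k != 0)) ->
  exists C, forall s : seq 'I_d, (forall i j, j != i -> ~~ near_tie C i j s) ->
    rho_pol (proj_sphere (scaled eta x1 s)) (proj_sphere (scaled eta x2 s)) < eps.
Proof.
move=> eta0 eps0 n1 n2 supp12.
have [m1 m10 H1] := finite_nonzero_lb (fun k => x1 0 k ^+ 2).
have [m2 m20 H2] := finite_nonzero_lb (fun k => x2 0 k ^+ 2).
pose q := ((1 + eta) ^+ 2)^-1.
have lam2 : 1 < (1 + eta) ^+ 2 by rewrite exprn_egt1// ltrDl.
have q0 : 0 < q by rewrite invr_gt0 (lt_trans ltr01).
have q1 : `|q| < 1 by rewrite gtr0_norm// invf_lt1 ?(lt_trans ltr01).
(* The squared distance will be at most 2 q^C (1/m1 + 1/m2), hence at most half of eps^2; the 4 in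
   place of 2 makes the final inequality strict. *)
pose e := eps ^+ 2 / (4 * (m1^-1 + m2^-1)).
have m12 : 0 < m1^-1 + m2^-1 by rewrite addr_gt0 ?invr_gt0.
have e0 : 0 < e by rewrite divr_gt0 ?exprn_gt0 ?mulr_gt0.
have [C _ /(_ _ (leqnn C)) HC] := cvgr0_norm_le _ (cvg_expr q1) _ e0.
have {}HC : q ^+ C <= e := le_trans (ler_norm _) HC.
exists C => s notie.
have [i xi imax] : exists2 i, x1 0 i != 0 &
    forall k, x1 0 k != 0 -> (count_mem k s <= count_mem i s)%N.
  have [i0 xi0] := norm2_eq1_neq0 _ n1.
  by case: (arg_maxnP (P := fun k => x1 0 k != 0) (fun k => count_mem k s) xi0) => i; exists i.
have lead k : x1 0 k != 0 -> k != i -> (count_mem k s + C <= count_mem i s)%N.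
  move=> xk ki; have := notie i k ki; rewrite negb_and -!ltnNge => /orP[/ltnW//|].
  by move/(leq_ltn_trans (leq_addr C _)); rewrite ltnNge imax.
have bound (x : 'rV[R]_d) m : norm2 x = 1 -> (forall k, (x1 0 k != 0) = (x 0 k != 0)) ->
    0 < m -> (forall k, x 0 k ^+ 2 != 0 -> m <= `|x 0 k ^+ 2|) ->
    1 - proj_sphere (scaled eta x s) 0 i ^+ 2 <= q ^+ C / m.
  move=> nx sx m0 Hm; have xi' : x 0 i != 0 by rewrite -sx.
  apply: le_trans (coord_proj_scaled eta eta0 x s i C nx xi' _) _.
    by move=> k; rewrite -sx; exact: lead.
  rewrite invfM -exprVn -/q ler_wpM2l ?exprn_ge0 ?(ltW q0)//.
  rewrite lef_pV2 ?posrE ?exprn_even_gt0//.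
  by have := Hm i; rewrite ger0_norm ?sqr_ge0//; apply; rewrite sqrf_eq0.
apply: le_lt_trans (rho_pol_le_coord _ _ i _ _) _.
- by rewrite norm2_proj_sphere// gt_eqF// norm2_scaled_gt0.
- by rewrite norm2_proj_sphere// gt_eqF// norm2_scaled_gt0.
rewrite -[ltRHS]ger0_norm ?(ltW eps0)// -sqrtr_sqr ltr_sqrt ?exprn_gt0//.
have b1 := bound x1 m1 n1 (fun=> erefl) m10 H1.
have b2 := bound x2 m2 n2 supp12 m20 H2.
have : q ^+ C * (4 * (m1^-1 + m2^-1)) <= eps ^+ 2.
  by rewrite -ler_pdivlMr// mulr_gt0.
have : 0 < eps ^+ 2 by rewrite exprn_gt0.
rewrite mulrDr mulrDr !mulrA in b1 b2 *; lra.
Qed.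

Theorem theorem4p11 (R : realType) (d : nat) (eta : R)
  (dm : measure_display) (T : measurableType dm) (P : probability T R)
  (xi : nat -> T -> 'I_d)
  (x1 x2 : 'rV[R]_d) :
  (1 <= d)%N -> 0 < eta ->
  (* xi_0, xi_1, ... are i.i.d. uniform on {e_1, ..., e_d} *)
  (forall (k : nat) (i : 'I_d), measurable [set w | xi k w = i]) ->
  (forall (n : nat) (s : nat -> 'I_d),
      P [set w | forall k, (k < n)%N -> xi k w = s k]
      = (((d%:R)^-1) ^+ n)%:E) ->
  (* initial opinions on the sphere, same support, X0^(1) <> +- X0^(2) *)
  norm2 x1 = 1 -> norm2 x2 = 1 ->
  supp x1 = supp x2 ->
  x1 != x2 -> x1 != - x2 ->
  (* (1) weak polarization *)
  (forall eps : R, 0 < eps ->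
     (fun t => P [set w | eps <= rho_pol (hjmr_traj eta (xi ^~ w) x1 t)
                                        (hjmr_traj eta (xi ^~ w) x2 t)])
       @ \oo --> 0%E)
  /\
  (* (2) a.s. the distance converges neither to 0 nor to 2 *)
  {ae P, forall w,
     ~ (seq_cvg_to (fun t => norm2 (hjmr_traj eta (xi ^~ w) x1 t
                         - hjmr_traj eta (xi ^~ w) x2 t)) 0) /\
     ~ (seq_cvg_to (fun t => norm2 (hjmr_traj eta (xi ^~ w) x1 t
                         - hjmr_traj eta (xi ^~ w) x2 t)) 2)}
  /\
  (* in particular, no strong polarization (a.s.) *)
  {ae P, forall w,
     ~ (seq_cvg_to (fun t => rho_pol (hjmr_traj eta (xi ^~ w) x1 t)
                          (hjmr_traj eta (xi ^~ w) x2 t)) 0)}.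
Proof.
move=> d0 eta0 xi_meas xi_cyl n1 n2 supp_eq x12 x12N.
have supp12 k : (x1 0 k != 0) = (x2 0 k != 0).
  by apply/idP/idP => xk; have := congr1 (fun A : set 'I_d => A k) supp_eq;
    rewrite /supp/= => E; move: xk; rewrite ?E -?E.
split.
  move=> eps eps0.
  have [C HC] := rho_pol_lt_of_no_tie eta eps x1 x2 eta0 eps0 n1 n2 supp12.
  pose p s := eps <= rho_pol (proj_sphere (scaled eta x1 s)) (proj_sphere (scaled eta x2 s)).
  rewrite (_ : (fun t => _) = (fun t => (word_mean t (fun s => (p s)%:R))%:E)); last first.
    apply/funext => t; rewrite -(prefix_prob P xi xi_meas xi_cyl t p d0).2; congr (P _).
    by apply/seteqP; split => w; rewrite /= /p !hjmr_trajE.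
  apply: cvg_EFin; first exact: nearW.
  apply: squeeze_cvgr _ (cvg_cst 0) (word_mean_ties_cvg0 d0 C); apply: nearW => t /=.
  rewrite word_mean_ge0//=.
  under eq_bigr do rewrite -word_mean_sum.
  rewrite -word_mean_sum; apply: ler_word_mean => s _.
  case ps: (p s); last by rewrite sumr_ge0// => i _; rewrite sumr_ge0.
  (* By the choice of [C], a distance of at least [eps] forces a near tie, so the sum of tie
     indicators dominates. *)
  have [i [j [ji tie]]] : exists i j, j != i /\ near_tie C i j s.
    apply: contrapT => notie; move: ps; rewrite /p leNgt HC// => i j ji.
    by apply/negP => tie; apply: notie; exists i, j.
  rewrite (bigD1 i)//= (bigD1 j)//= tie -addrA lerDl addr_ge0 ?sumr_ge0// => k _.
  by rewrite sumr_ge0.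
have [i [j xij]] := cross_neq0_exists x1 x2 n1 n2 x12 x12N.
have [delta delta0 Hdelta] := finite_nonzero_lb (fun ab => cross x1 x2 ab.1 ab.2).
have rho_io : {ae P, forall w, forall t0, exists2 t, (t0 <= t)%N &
    delta / 4 <= rho_pol (hjmr_traj eta (xi ^~ w) x1 t) (hjmr_traj eta (xi ^~ w) x2 t)}.
  have lead_io := ae_leads_io P xi d0 xi_meas xi_cyl.
  apply: filterS2 (lead_io i) (lead_io j) => w ioi ioj t0.
  have Si : x1 0 i != 0.
    apply: contra xij => /eqP xi0; move: (supp12 i).
    by rewrite /cross xi0 eqxx /= => /esym/negbFE/eqP ->; rewrite mul0r mulr0 subrr.
  have Sj : x1 0 j != 0.
    apply: contra xij => /eqP xi0; move: (supp12 j).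
    by rewrite /cross xi0 eqxx /= => /esym/negbFE/eqP ->; rewrite mul0r mulr0 subrr.
  (* Here [S] is the common support, and [A] collects the columns proportional to column [i], which
     excludes [j]. *)
  have [|t [a [b [t0t /andP[Sa Aa] /andP[Sb Ab] Nab amax]]]] :=
    tied_leaders_io (xi ^~ w) (fun k => x1 0 k != 0) (fun k => cross x1 x2 i k == 0)
      i j Si Sj _ xij ioi ioj t0.
    by rewrite /cross subrr.
  exists t => //; rewrite !hjmr_trajE//.
  apply: le_trans (cross_le_rho_pol _ _ a b _ _); first last.
  - by rewrite norm2_proj_sphere// gt_eqF// norm2_scaled_gt0.
  - by rewrite norm2_proj_sphere// gt_eqF// norm2_scaled_gt0.
  rewrite ler_pM2r//; apply: le_trans (cross_proj_scaled eta eta0 _ _ _ _ _ n1 n2 _ _ _) => //.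
  (* Proportionality is transitive through the nonzero column [a]: if the minor at [a], [b]
     vanished, column [b] would be proportional to column [i]. *)
  - apply: (Hdelta (a, b)); apply: contra Ab => /= /eqP ab0; move/eqP: Aa => ia0.
    have ya : x2 0 a != 0 by rewrite -supp12.
    rewrite /cross -(inj_eq (mulIf ya)) mul0r; apply/eqP.
    move: ab0 ia0; rewrite /cross => /eqP + /eqP; rewrite !subr_eq0 => /eqP E1 /eqP E2.
    by rewrite mulrBl mulrAC E2 mulrAC E1; ring.
  - by move=> k; rewrite -supp12; exact: amax.
have unit (x : 'rV[R]_d) w t : norm2 x = 1 -> norm2 (hjmr_traj eta (xi ^~ w) x t) = 1.
  by move=> x1'; rewrite hjmr_trajE// norm2_proj_sphere// gt_eqF// norm2_scaled_gt0.
have d4 : 0 < delta / 4 by rewrite divr_gt0.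
have not_small (u : nat -> R) : (forall t0, exists2 t, (t0 <= t)%N & delta / 4 <= u t) ->
    ~ seq_cvg_to u 0.
  move=> uio u0; have d8 : 0 < delta / 8 by rewrite divr_gt0.
  have [t0 _ Ht0] := cvgr0_norm_le _ u0 _ d8; have [t t0t ut] := uio t0.
  by have := le_trans ut (le_trans (ler_norm _) (Ht0 t t0t)); lra.
split; apply: filterS rho_io => w rho_io; last exact: not_small.
split.
  apply: not_small => t0; have [t t0t rt] := rho_io t0; exists t => //.
  by apply: le_trans rt (rho_pol_le_sub _ _ (unit _ _ _ n2)).
move=> dist2.
(* By the parallelogram law, distance tending to 2 would make the sum of the opinions tend to 0,
   although its norm bounds the distance to the polarized set from above. *)
pose sq t := norm2 (hjmr_traj eta (xi ^~ w) x1 t + hjmr_traj eta (xi ^~ w) x2 t) ^+ 2.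
have sqE t : sq t = 4 - norm2 (hjmr_traj eta (xi ^~ w) x1 t - hjmr_traj eta (xi ^~ w) x2 t) ^+ 2.
  by have := norm2_parallelogram _ _ (unit _ w t n1) (unit _ w t n2); rewrite /sq; lra.
have sq0 : sq t @[t --> \oo] --> 0.
  have <- : 4 - 2 * 2 = 0 :> R by ring.
  by rewrite (funext sqE : sq = _); exact: cvgB (cvg_cst _) (cvgM dist2 dist2).
have d16 : 0 < (delta / 4) ^+ 2 / 2 by rewrite divr_gt0 ?exprn_gt0.
have [t0 _ Ht0] := cvgr0_norm_le _ sq0 _ d16; have [t t0t rt] := rho_io t0.
have := le_trans (ler_norm _) (Ht0 t t0t).
have : (delta / 4) ^+ 2 <= sq t.
  rewrite /sq ler_pXn2r ?nnegrE ?norm2_ge0 ?(ltW d4)//.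
  exact: le_trans rt (rho_pol_le_add _ _ (unit _ _ _ n2)).
have : 0 < (delta / 4) ^+ 2 by rewrite exprn_gt0.
lra.
Qed.
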